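(* For $\lambda\in\mathbb{R}\setminus[-1,2]$ and $k\in\{1,2,3,4\}$, the asymptote $\mathcal{A}_k(\lambda)$ of the touching curve $\mathcal{C}_\lambda$ tends to the asymptote $\widetilde{\mathcal{A}}_k$ of the edge of regression $\mathcal{R}$ if $\lambda\to\pm\infty$.
   Context: The extended oloid $\mathcal{O}$ is the developable surface containing the surface of the convex hull of the circles $k_A: x^2+(y+\frac12)^2=1, z=0$ and $k_B:(y-\frac12)^2+z^2=1, x=0$. Its inscribed quadrics are $\mathcal{Q}_\lambda:\ \frac{x^2}{1-\lambda}+\frac{(y-\lambda+1/2)^2}{1-\lambda+\lambda^2}+\frac{z^2}{\lambda}=1$. The touching curve $\mathcal{C}_\lambda$, along which $\mathcal{O}$ and $\mathcal{Q}_\lambda$ touch, is parametrized by $\gamma(\lambda,t)=(\kappa_1,\kappa_2,\kappa_3)(\lambda,t)$ for $t\in[-\frac{2\pi}3,\frac{2\pi}3]$ and $\gamma(\lambda,t)=(\kappa_1,\kappa_2,-\kappa_3)(\lambda,\frac{4\pi}3-t)$ for $t\in(\frac{2\pi}3,2\pi]$, where $$\kappa_1(\lambda,t)=\frac{(1-\lambda)\sin t}{1+\lambda\cos t},\quad \kappa_2(\lambda,t)=\frac{2\lambda-1+(\lambda-2)\cos t}{2(1+\lambda\cos t)},\quad \kappa_3(\lambda,t)=\frac{\lambda\sqrt{1+2\cos t}}{1+\lambda\cos t}.$$ For $\lambda\in\mathbb{R}\setminus[-1,2]$ the parametrization has the four poles $t_1=-\arccos(-\frac1\lambda)$, $t_2=\arccos(-\frac1\lambda)$,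 $t_3=\frac{4\pi}3-\arccos(-\frac1\lambda)$, $t_4=\frac{4\pi}3+\arccos(-\frac1\lambda)$, and $\mathcal{A}_k(\lambda)$ denotes the asymptote of $\mathcal{C}_\lambda$ at the pole $t_k$. Explicitly, with $$\tilde\tau_1(\lambda,\nu)=\frac{1-\lambda+\lambda^2}{2+\lambda-\lambda^2}\sqrt{1-\frac1{\lambda^2}}\,(1-\nu),\qquad \tilde\tau_2(\lambda,\nu)=\frac{2-2\lambda-\lambda^2}{2\lambda(\lambda-2)}+\nu\,\frac{(1-\lambda+\lambda^2)^2}{\lambda(\lambda-2)(\lambda^2-1)},$$ $$\tilde\tau_3(\lambda,\nu)=\nu\,\frac{1-\lambda+\lambda^2}{\lambda^2-1}\sqrt{\frac{\lambda}{\lambda-2}},$$ one has $\mathcal{A}_1(\lambda)=\{(\tilde\tau_1,\tilde\tau_2,\tilde\tau_3)(\lambda,\nu):\nu\in\mathbb{R}\}$, $\mathcal{A}_2(\lambda)=\{(-\tilde\tau_1,\tilde\tau_2,\tilde\tau_3)(\lambda,\nu):\nu\in\mathbb{R}\}$, $\mathcal{A}_3(\lambda)=\{(-\tilde\tau_1,\tilde\tau_2,-\tilde\tau_3)(\lambda,\nu):\nu\in\mathbb{R}\}$, $\mathcal{A}_4(\lambda)=\{(\tilde\tau_1,\tilde\tau_2,-\tilde\tau_3)(\lambda,\nu):\nu\in\mathbb{R}\}$. The edge of regression $\mathcal{R}$ of $\mathcal{O}$ (the curve to which all generating lines of $\mathcal{O}$ are tangent) is given by $x=\frac{\sin t-\tan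 t}3$, $y=\frac{2+3\cos t-3\cos^2t-2\cos^3t}{6(1+\cos t)\cos t}$, $z=\pm\frac{(1+2\cos t)^{3/2}}{3(1+\cos t)\cos t}$, $t\in[-\frac{2\pi}3,\frac{2\pi}3]$, $t\ne\pm\frac\pi2$. Its four asymptotes (at the poles $t=\pm\frac\pi2$) are $\widetilde{\mathcal{A}}_1=\{(m-1,m-\frac12,m):m\in\mathbb{R}\}$, $\widetilde{\mathcal{A}}_2=\{(1-m,m-\frac12,m):m\in\mathbb{R}\}$, $\widetilde{\mathcal{A}}_3=\{(1-m,m-\frac12,-m):m\in\mathbb{R}\}$, $\widetilde{\mathcal{A}}_4=\{(m-1,m-\frac12,-m):m\in\mathbb{R}\}$. ''Tends to'' means convergence of lines in $\mathbb{R}^3$ (e.g. pointwise convergence, for each fixed value $\nu=m$ of the line parameter, of the affine parametrization $\nu\mapsto(\pm\tilde\tau_1,\tilde\tau_2,\pm\tilde\tau_3)(\lambda,\nu)$ of $\mathcal{A}_k(\lambda)$, with the signs belonging to $k$, to the affine parametrization $m\mapsto(\pm(m-1),m-\frac12,\pm m)$ of $\widetilde{\mathcal{A}}_k$, with the same signs). *)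

(* Defs.v *)
From Stdlib Require Import Reals.
From Coquelicot Require Import Coquelicot.
Open Scope R_scope.

(* The product norm of Coquelicot is sqrt (|x|^2 + |y|^2), so this is Euclidean
   3-space; a point (x, y, z) is ((x, y), z). *)
Definition R3 : NormedModule R_AbsRing :=
  prod_NormedModule R_AbsRing
    (prod_NormedModule R_AbsRing R_NormedModule R_NormedModule) R_NormedModule.

Definition point (x y z : R) : R3 := ((x, y), z).

Definition is_line (L : R3 -> Prop) : Prop :=
  exists p v : R3, v <> zero /\
    forall q : R3, L q <-> exists m : R, q = plus p (scal m v).

Definition image (g : R -> R3) : R3 -> Prop := fun q => exists m : R, q = g m.

(* L is an asymptote of the curve f at the pole t0: f is unbounded at t0, and
   the distance from f t to the line L tends to 0 as t tends to t0, t <> t0. *)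
Definition is_asymptote (f : R -> R3) (t0 : R) (L : R3 -> Prop) : Prop :=
  is_line L /\
  filterlim (fun t => norm (f t)) (locally' t0) (Rbar_locally p_infty) /\
  forall eps : posreal,
    locally' t0 (fun t => exists q : R3, L q /\ norm (minus (f t) q) < eps).

Definition lines_tend_to (F : (R -> Prop) -> Prop)
    (g : R -> R -> R3) (g0 : R -> R3) : Prop :=
  forall m : R, filterlim (fun l => g l m) F (locally (g0 m)).

Inductive index : Set := k1 | k2 | k3 | k4.

(* Signs of the x- and z-components of the k-th asymptotes, relative to
   (tau1, tau2, tau3), respectively to (m - 1, m - 1/2, m). *)
Definition sign_x (k : index) : R :=
  match k with k1 => 1 | k2 => -1 | k3 => -1 | k4 => 1 end.
Definition sign_z (k : index) : R :=
  match k with k1 => 1 | k2 => 1 | k3 => -1 | k4 => -1 end.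

Definition kappa1 (l t : R) : R := (1 - l) * sin t / (1 + l * cos t).
Definition kappa2 (l t : R) : R :=
  (2 * l - 1 + (l - 2) * cos t) / (2 * (1 + l * cos t)).
Definition kappa3 (l t : R) : R := l * sqrt (1 + 2 * cos t) / (1 + l * cos t).

(* Only meaningful for t in [-2 PI / 3, 2 PI]; for l outside [-1, 2] the four
   poles lie in the interior of one of the two pieces of this interval. *)
Definition touching_curve (l t : R) : R3 :=
  if Rle_dec t (2 * PI / 3)
  then point (kappa1 l t) (kappa2 l t) (kappa3 l t)
  else point (kappa1 l (4 * PI / 3 - t)) (kappa2 l (4 * PI / 3 - t))
             (- kappa3 l (4 * PI / 3 - t)).

Definition touching_pole (k : index) (l : R) : R :=
  match k with
  | k1 => - acos (- (1 / l))
  | k2 => acos (- (1 / l))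
  | k3 => 4 * PI / 3 - acos (- (1 / l))
  | k4 => 4 * PI / 3 + acos (- (1 / l))
  end.

Definition tau1 (l nu : R) : R :=
  (1 - l + l ^ 2) / (2 + l - l ^ 2) * sqrt (1 - 1 / l ^ 2) * (1 - nu).
Definition tau2 (l nu : R) : R :=
  (2 - 2 * l - l ^ 2) / (2 * l * (l - 2))
  + nu * ((1 - l + l ^ 2) ^ 2 / (l * (l - 2) * (l ^ 2 - 1))).
Definition tau3 (l nu : R) : R :=
  nu * ((1 - l + l ^ 2) / (l ^ 2 - 1)) * sqrt (l / (l - 2)).

Definition touching_asymptote (k : index) (l nu : R) : R3 :=
  point (sign_x k * tau1 l nu) (tau2 l nu) (sign_z k * tau3 l nu).

(* The branch of the edge of regression with sign s = 1 or s = -1 in z, for t in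
   [-2 PI / 3, 2 PI / 3]. The power 3/2 is written sqrt _ ^ 3 because
   Rpower 0 _ is not 0. *)
Definition edge_of_regression (s t : R) : R3 :=
  point ((sin t - tan t) / 3)
        ((2 + 3 * cos t - 3 * cos t ^ 2 - 2 * cos t ^ 3)
           / (6 * (1 + cos t) * cos t))
        (s * (sqrt (1 + 2 * cos t) ^ 3 / (3 * (1 + cos t) * cos t))).

(* touching_pole k l (after undoing the reflection t |-> 4 PI / 3 - t on the
   second piece) tends to this pole as l tends to infinity. *)
Definition edge_pole (k : index) : R :=
  match k with
  | k1 => - (PI / 2) | k2 => PI / 2 | k3 => PI / 2 | k4 => - (PI / 2)
  end.

Definition edge_asymptote (k : index) (m : R) : R3 :=
  point (sign_x k * (m - 1)) (m - 1 / 2) (sign_z k * m).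

(* Main.v *)
Require Import Defs.
From Stdlib Require Import Reals Lra Psatz.
From Coquelicot Require Import Coquelicot.
Open Scope R_scope.

(** Each of the curves involved has the form [N t / d t] near its pole [t0],
    with [N] differentiable in space and [d] having a simple zero at [t0].
    Writing
      [N t / d t = N t0 / d t + (N t - N t0) / d t],
    the last term is a quotient of two difference quotients, so it tends to
    [N' t0 / d' t0], while the first one runs to infinity along the direction
    [N t0]. Hence the asymptote is the line
      [{N' t0 / d' t0 + m N t0 | m real}]
    ([asymptote_at_simple_pole]), and to recognise a given parametrized line as
    this asymptote is to find the affine change of parameter between the two.

    For the touching curve, [d t = 1 + l cos t] vanishes where
    [cos t = - 1 / l]; for [l] outside [[-1, 2]] this value lies strictly
    between [-1/2] and [1], so that [d] has a simple zero there, the square root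
    in [kappa3] is differentiable, and the pole lies inside the piece of the curve
    to which it belongs. The four poles come from two of them by the reflection
    [t |-> 4 PI / 3 - t]. For the edge of regression, [d = cos] and the poles
    are [- PI / 2] and [PI / 2].

    The convergence of the asymptotes is a matter of continuity: in terms of
    [u = 1 / l] the coordinates [tau1], [tau2], [tau3] are given by expressions
    that are continuous at [u = 0], and [u] tends to [0] both for [l] tending to
    plus infinity and for [l] tending to minus infinity
    ([touching_asymptote_limit]). *)

(** * Convergence in space *)

Lemma filterlim_point {T : Type} (F : (T -> Prop) -> Prop) {FF : Filter F}
    (x y z : T -> R) (a b c : R) :
  filterlim x F (locally a) -> filterlim y F (locally b) ->
  filterlim z F (locally c) ->
  filterlim (fun t => point (x t) (y t) (z t)) F (locally (point a b c)).
Proof.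
  intros Hx Hy Hz. apply filterlim_locally. intros eps.
  generalize (proj1 (filterlim_locally x a) Hx eps)
    (proj1 (filterlim_locally y b) Hy eps) (proj1 (filterlim_locally z c) Hz eps).
  intros Bx By Bz.
  generalize (filter_and _ _ Bx (filter_and _ _ By Bz)).
  apply filter_imp. intros t [tx [ty tz]]. repeat split; assumption.
Qed.

Lemma point_plus_scal (a b c m u v w : R) :
  plus (point a b c) (scal m (point u v w))
  = point (a + m * u) (b + m * v) (c + m * w).
Proof. reflexivity. Qed.

(** * Asymptotes from expansions at a pole *)

Lemma minus_plus_swap {G : AbelianGroup} (a b c : G) :
  minus a (plus b c) = minus (minus a c) b.
Proof.
  unfold minus. rewrite opp_plus, <- plus_assoc. f_equal. apply plus_comm.
Qed.

(** If [f t = r t * v + w + o(1)] with [|r|] tending to infinity, then the point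
    [w + r t * v] of the line through [w] with direction [v] approaches [f t],
    and [f] is unbounded because [v] is nonzero. *)
Lemma asymptote_of_expansion (f : R -> R3) (t0 : R) (r : R -> R) (v w : R3)
    (L : R3 -> Prop) :
  v <> zero ->
  (forall q, L q <-> exists m : R, q = plus w (scal m v)) ->
  filterlim (fun t => Rabs (r t)) (locally' t0) (Rbar_locally p_infty) ->
  filterlim (fun t => minus (f t) (scal (r t) v)) (locally' t0) (locally w) ->
  is_asymptote f t0 L.
Proof.
  intros Hv HL Hr Hf.
  assert (Hball := proj1 (filterlim_locally_ball_norm _ _) Hf).
  assert (Hv0 : 0 < norm v).
  { destruct (norm_ge_0 v) as [H | H]; [exact H |].
    exfalso. apply Hv. now apply norm_eq_zero. }
  split; [| split].
  - exists w, v. split; assumption.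
  - intros P [M HM].
    assert (Hbig : locally' t0
        (fun t => Rmax 0 ((M + norm w + 1) / norm v) < Rabs (r t))).
    { apply (Hr (fun y => Rmax 0 ((M + norm w + 1) / norm v) < y)).
      exists (Rmax 0 ((M + norm w + 1) / norm v)). intros y Hy. exact Hy. }
    generalize (filter_and _ _ Hbig (Hball (mkposreal 1 Rlt_0_1))).
    unfold filtermap. apply filter_imp. intros t [Ht Hb]. apply HM.
    unfold ball_norm in Hb. simpl in Hb.
    assert (Hr0 : 0 < Rabs (r t)).
    { apply Rle_lt_trans with (2 := Ht), Rmax_l. }
    assert (Hrn : r t <> 0) by (intro E; rewrite E, Rabs_R0 in Hr0; lra).
    assert (Hlow : Rabs (r t) * norm v <= norm (scal (r t) v)).
    { assert (E : scal (/ r t) (scal (r t) v) = v).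
      { rewrite scal_assoc. change (scal (/ r t * r t) v = v).
        rewrite (Rinv_l _ Hrn). exact (scal_one v). }
      assert (H : norm (scal (/ r t) (scal (r t) v))
                  <= Rabs (/ r t) * norm (scal (r t) v)) by exact (norm_scal _ _).
      rewrite E, Rabs_inv in H.
      apply (Rmult_le_compat_l (Rabs (r t))) in H; [| lra].
      rewrite <- Rmult_assoc, Rinv_r, Rmult_1_l in H; [exact H | lra]. }
    assert (Hprod : M + norm w + 1 < Rabs (r t) * norm v).
    { apply Rlt_div_l; [exact Hv0 |].
      apply Rle_lt_trans with (2 := Ht), Rmax_r. }
    assert (T1 := norm_triangle_inv (f t) (scal (r t) v)).
    assert (T2 := norm_triangle_inv (minus (f t) (scal (r t) v)) w).
    apply Rabs_le_between in T1. apply Rabs_le_between in T2.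
    lra.
  - intros eps. generalize (Hball eps). apply filter_imp. intros t Ht.
    exists (plus w (scal (r t) v)). split; [apply HL; now exists (r t) |].
    unfold ball_norm in Ht.
    replace (minus (f t) (plus w (scal (r t) v)))
      with (minus (minus (f t) (scal (r t) v)) w); [exact Ht |].
    symmetry. exact (minus_plus_swap (G := R3) _ _ _).
Qed.

Lemma filterlim_slope (f : R -> R) (x l : R) :
  is_derive f x l ->
  filterlim (fun t => (f t - f x) / (t - x)) (locally' x) (locally l).
Proof.
  intros H. apply is_derive_Reals in H. apply filterlim_locally. intros eps.
  destruct (H eps (cond_pos eps)) as [delta Hd].
  exists delta. intros t Ht Hne.
  specialize (Hd (t - x)). rewrite Rplus_minus in Hd.
  apply Hd; [lra | exact Ht].
Qed.

Lemma simple_zero_isolated (d : R -> R) (t0 d' : R) :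
  is_derive d t0 d' -> d t0 = 0 -> d' <> 0 -> locally' t0 (fun t => d t <> 0).
Proof.
  intros Hd H0 Hd'.
  assert (Hpos : 0 < Rabs d') by now apply Rabs_pos_lt.
  generalize (proj1 (filterlim_locally _ _) (filterlim_slope _ _ _ Hd)
                (mkposreal _ Hpos)).
  apply filter_imp. intros t Ht E.
  change (Rabs ((d t - d t0) / (t - t0) - d') < Rabs d') in Ht.
  rewrite E, H0 in Ht.
  replace ((0 - 0) / (t - t0) - d') with (- d') in Ht by (unfold Rdiv; ring).
  rewrite Rabs_Ropp in Ht. lra.
Qed.

Lemma filterlim_inv_simple_zero (d : R -> R) (t0 d' : R) :
  is_derive d t0 d' -> d t0 = 0 -> d' <> 0 ->
  filterlim (fun t => Rabs (/ d t)) (locally' t0) (Rbar_locally p_infty).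
Proof.
  intros Hd H0 Hd'.
  assert (Hlim : filterlim d (locally' t0) (locally' 0)).
  { assert (Hc : filterlim d (locally t0) (locally 0)).
    { rewrite <- H0. apply (ex_derive_continuous (V := R_NormedModule)).
      now exists d'. }
    intros P HP.
    assert (Hn := simple_zero_isolated _ _ _ Hd H0 Hd').
    assert (HPd : locally' t0 (fun t => d t <> 0 -> P (d t))).
    { apply filter_le_within. exact (Hc (fun y => y <> 0 -> P y) HP). }
    generalize (filter_and _ _ HPd Hn).
    unfold filtermap. apply filter_imp. intros t [Ht Hnt]. exact (Ht Hnt). }
  apply filterlim_ext with (fun t => / Rabs (d t)).
  { intros t. symmetry. apply Rabs_inv. }
  apply filterlim_comp with (2 := filterlim_Rinv_0_right).
  apply filterlim_comp with (1 := Hlim).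
  apply (filterlim_abs_0 (K := R_AbsRing)). exact Rabs_eq_0.
Qed.

(** Since [d t0 = 0], the remainder [(n t - n t0) / d t] is the quotient of the
    difference quotients of [n] and [d]. *)
Lemma filterlim_pole_remainder (n d : R -> R) (t0 n' d' : R) :
  is_derive n t0 n' -> is_derive d t0 d' -> d t0 = 0 -> d' <> 0 ->
  filterlim (fun t => n t / d t - / d t * n t0) (locally' t0) (locally (n' / d')).
Proof.
  intros Hn Hd H0 Hd'.
  change (is_lim (fun t => n t / d t - / d t * n t0) t0 (n' / d')).
  apply is_lim_ext_loc with
    (fun t => ((n t - n t0) / (t - t0)) / ((d t - d t0) / (t - t0))).
  - generalize (simple_zero_isolated _ _ _ Hd H0 Hd').
    intros [eps He]. exists eps. intros t Ht Hne.
    specialize (He t Ht Hne). rewrite H0. field. split; lra.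
  - apply (is_lim_div _ _ t0 n' d').
    + exact (filterlim_slope _ _ _ Hn).
    + exact (filterlim_slope _ _ _ Hd).
    + intros E. now injection E.
    + exact I.
Qed.

(** The last hypothesis says that the given parametrization [a] of a line is,
    after the affine change of parameter [m |-> m0 + c * m], the parametrization
    of the asymptote with base point [N' / d'] and direction [N t0]. *)
Lemma asymptote_at_simple_pole (d x y z : R -> R) (t0 d' x' y' z' : R)
    (a : R -> R3) (m0 c : R) :
  is_derive d t0 d' -> is_derive x t0 x' -> is_derive y t0 y' ->
  is_derive z t0 z' ->
  d t0 = 0 -> d' <> 0 -> c <> 0 -> point (x t0) (y t0) (z t0) <> zero ->
  (forall m, a (m0 + c * m)
     = point (x' / d' + m * x t0) (y' / d' + m * y t0) (z' / d' + m * z t0)) ->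
  is_asymptote (fun t => point (x t / d t) (y t / d t) (z t / d t)) t0 (image a).
Proof.
  intros Hd Hx Hy Hz H0 Hd' Hc Hv Ha.
  apply asymptote_of_expansion with (r := fun t => / d t)
    (v := point (x t0) (y t0) (z t0))
    (w := point (x' / d') (y' / d') (z' / d')).
  - exact Hv.
  - intros q. split; intros [m Hm].
    + exists ((m - m0) / c). rewrite Hm, point_plus_scal, <- Ha.
      f_equal. field. exact Hc.
    + exists (m0 + c * m). now rewrite Hm, Ha, point_plus_scal.
  - now apply filterlim_inv_simple_zero with d'.
  - change (filterlim (fun t => point (x t / d t - / d t * x t0)
      (y t / d t - / d t * y t0) (z t / d t - / d t * z t0))
      (locally' t0) (locally (point (x' / d') (y' / d') (z' / d')))).
    apply (filterlim_point (locally' t0));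
      now apply filterlim_pole_remainder.
Qed.

(** The curves are defined piecewise and with unequal denominators, so they are
    of the form treated above only near the pole and away from it. *)
Lemma is_asymptote_ext_loc (f g : R -> R3) (t0 : R) (L : R3 -> Prop) :
  locally' t0 (fun t => f t = g t) -> is_asymptote f t0 L -> is_asymptote g t0 L.
Proof.
  intros Hfg [HL [Hinf Hdist]]. split; [exact HL | split].
  - apply filterlim_ext_loc with (2 := Hinf).
    revert Hfg. apply filter_imp. intros t Ht. now rewrite Ht.
  - intros eps. generalize (filter_and _ _ Hfg (Hdist eps)).
    apply filter_imp. intros t [Ht Hq]. now rewrite <- Ht.
Qed.

Lemma is_asymptote_reflect (f : R -> R3) (b t0 : R) (L : R3 -> Prop) :
  is_asymptote f t0 L -> is_asymptote (fun t => f (b - t)) (b - t0) L.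
Proof.
  intros [HL [Hinf Hdist]].
  assert (Hr : filterlim (fun t => b - t) (locally' (b - t0)) (locally' t0)).
  { intros P [eps He]. exists eps. intros t Ht Hne. apply He.
    - change (Rabs (b - t - t0) < eps). change (Rabs (t - (b - t0)) < eps) in Ht.
      rewrite <- Rabs_Ropp. now replace (- (b - t - t0)) with (t - (b - t0)) by ring.
    - intros E. apply Hne. lra. }
  split; [exact HL | split].
  - exact (filterlim_comp _ _ _ _ _ _ _ _ Hr Hinf).
  - intros eps. exact (Hr _ (Hdist eps)).
Qed.

(** * Asymptotes of the touching curves *)

Lemma sign_x_sqr (k : index) : sign_x k * sign_x k = 1.
Proof. destruct k; simpl; ring. Qed.

Lemma cos_sign (k : index) (t : R) : cos (- sign_x k * t) = cos t.
Proof.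
  destruct k; simpl.
  1, 4: rewrite <- (cos_neg t).
  all: f_equal; ring.
Qed.

Lemma sin_sign (k : index) (t : R) : sin (- sign_x k * t) = - sign_x k * sin t.
Proof.
  destruct k; simpl.
  1, 4: replace (- (1) * t) with (- t) by ring; rewrite sin_neg; ring.
  all: replace (- -1 * t) with t by ring; ring.
Qed.

(** These bounds on the cosine at a pole put the pole in the open interval where
    [1 + 2 * cos t] is positive and [sin t] does not vanish. *)
Lemma touching_inv_bounds (l : R) : ~ (-1 <= l <= 2) -> -1 / 2 < - (1 / l) < 1.
Proof.
  intros Hl.
  assert (E : l * (1 / l) = 1) by (field; lra).
  destruct (Rlt_le_dec l (-1)) as [H | H]; [| assert (2 < l) by lra]; nra.
Qed.

Lemma tau_denominators_neq_0 (l : R) :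
  ~ (-1 <= l <= 2) -> 2 + l - l ^ 2 <> 0 /\ l ^ 2 - 1 <> 0.
Proof.
  intros Hl.
  replace (2 + l - l ^ 2) with (- ((l + 1) * (l - 2))) by ring.
  replace (l ^ 2 - 1) with ((l - 1) * (l + 1)) by ring.
  split; [apply Ropp_neq_0_compat |];
    apply Rmult_integral_contrapositive_currified; lra.
Qed.

(** Both pieces of the touching curve, mirror images in [z = 0], over the same
    parameter interval, before the second one is reparametrized. The pole
    [acos (- (1 / l))] belongs to the lines with [sign_x k = -1], its opposite
    to those with [sign_x k = 1]. *)
Lemma touching_piece_asymptote (k : index) (l : R) :
  ~ (-1 <= l <= 2) ->
  is_asymptote (fun t => point (kappa1 l t) (kappa2 l t) (sign_z k * kappa3 l t))
    (- sign_x k * acos (- (1 / l))) (image (touching_asymptote k l)).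
Proof.
  intros Hl.
  assert (Hb := touching_inv_bounds l Hl).
  set (t0 := - sign_x k * acos (- (1 / l))).
  assert (Hl0 : l <> 0) by lra.
  assert (Hcos : cos t0 = - (1 / l)).
  { unfold t0. rewrite cos_sign. apply cos_acos. lra. }
  set (s := sqrt (1 - 1 / l ^ 2)).
  assert (Hsin : sin t0 = - sign_x k * s).
  { unfold t0. rewrite sin_sign, sin_acos by lra. unfold s.
    do 2 f_equal. unfold Rsqr. field. exact Hl0. }
  assert (Hsp : 0 < 1 - 1 / l ^ 2).
  { replace (1 - 1 / l ^ 2) with ((1 - - (1 / l)) * (1 + - (1 / l)))
      by (field; exact Hl0). apply Rmult_lt_0_compat; lra. }
  assert (Hs0 : 0 < s) by now apply sqrt_lt_R0.
  assert (Hss : s * s = 1 - 1 / l ^ 2) by (apply sqrt_sqrt; lra).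
  set (w := sqrt (1 + 2 * cos t0)).
  assert (Hwp : 0 < 1 + 2 * cos t0) by (rewrite Hcos; lra).
  assert (Hw0 : 0 < w) by now apply sqrt_lt_R0.
  assert (Hww : w * w = (l - 2) / l).
  { unfold w. rewrite sqrt_sqrt by lra. rewrite Hcos. field. exact Hl0. }
  assert (Hwi : sqrt (l / (l - 2)) = / w).
  { unfold w. rewrite <- sqrt_inv, Hcos. f_equal. field. lra. }
  assert (Hq : 0 < 1 - l + l ^ 2) by nra.
  assert (He := sign_x_sqr k).
  assert (He0 : sign_x k <> 0) by (intro E; rewrite E in He; lra).
  apply is_asymptote_ext_loc with (fun t => point
    ((1 - l) * sin t / (1 + l * cos t))
    ((2 * l - 1 + (l - 2) * cos t) / 2 / (1 + l * cos t))
    (sign_z k * (l * sqrt (1 + 2 * cos t)) / (1 + l * cos t))).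
  { apply filter_forall. intros t. unfold kappa1, kappa2, kappa3, Rdiv.
    now rewrite Rinv_mult, !Rmult_assoc. }
  apply asymptote_at_simple_pole with
    (d' := l * sign_x k * s)
    (x' := - (1 - l) / l)
    (y' := (l - 2) * sign_x k * s / 2)
    (z' := sign_z k * (l * sign_x k * s / w))
    (* [m0] is the parameter at which the third coordinate of the asymptote is
       [sign_z k / w], that of the base point; [c] is the ratio of the second
       coordinates of the two direction vectors. *)
    (m0 := (l ^ 2 - 1) / (1 - l + l ^ 2))
    (c := (l - 2) * (l ^ 2 - 1) / (1 - l + l ^ 2)).
  - auto_derive; [easy |]. rewrite Hsin. ring.
  - auto_derive; [easy |]. rewrite Hcos. field. exact Hl0.
  - auto_derive; [easy |]. rewrite Hsin. field.
  - auto_derive; [exact Hwp |]. fold w. rewrite Hsin. field. lra.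
  - rewrite Hcos. field. exact Hl0.
  - repeat apply Rmult_integral_contrapositive_currified; lra.
  - destruct (tau_denominators_neq_0 l Hl) as [H4 H5].
    apply Rmult_integral_contrapositive_currified;
      [apply Rmult_integral_contrapositive_currified; lra |].
    apply Rinv_neq_0_compat. lra.
  - intros E. apply (f_equal (fun q : R3 => snd (fst q))) in E.
    cbn in E. rewrite Hcos in E.
    replace ((2 * l - 1 + (l - 2) * - (1 / l)) / 2)
      with ((1 - l + l ^ 2) * / l) in E by (field; exact Hl0).
    apply Rmult_integral in E. destruct E as [E | E]; [lra |].
    now apply (Rinv_neq_0_compat l).
  - intros m. unfold touching_asymptote, tau1, tau2, tau3. fold s w.
    rewrite Hwi, Hsin, Hcos.
    assert (H1 : l + 1 <> 0) by lra.
    assert (H2 : l - 2 <> 0) by lra.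
    assert (H3 : l - 1 <> 0) by lra.
    destruct (tau_denominators_neq_0 l Hl) as [H4 H5].
    assert (H6 : 1 - l + l ^ 2 <> 0) by lra.
    (* With the relations for [sign_x k], [s] and [w] used in this form, what
       remains are identities of rational functions. *)
    assert (Hx : - (1 - l) / l / (l * sign_x k * s) = sign_x k * s / (l + 1)).
    { apply (Rmult_eq_reg_r (l * sign_x k * s)).
      2: repeat apply Rmult_integral_contrapositive_currified; lra.
      replace (sign_x k * s / (l + 1) * (l * sign_x k * s))
        with (l / (l + 1) * (sign_x k * sign_x k) * (s * s)) by (field; exact H1).
      rewrite He, Hss. field. repeat split; lra. }
    assert (Hz : l * w = (l - 2) / w).
    { apply (Rmult_eq_reg_r w); [| lra].
      rewrite Rmult_assoc, Hww. field. lra. }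
    rewrite Hx. f_equal.
    + field. repeat split; assumption.
    + field. repeat split; try assumption; lra.
    + rewrite Hz. field. repeat split; try assumption; lra.
Qed.

(** The poles of the first piece lie below the junction [2 * PI / 3], the
    reflected ones above it, so near each pole the touching curve is given by a
    single one of its two formulas. *)
Lemma touching_curve_asymptote (k : index) (l : R) :
  ~ (-1 <= l <= 2) ->
  is_asymptote (touching_curve l) (touching_pole k l)
    (image (touching_asymptote k l)).
Proof.
  intros Hl.
  assert (Hb := touching_inv_bounds l Hl).
  assert (HT : 0 < acos (- (1 / l)) < 2 * PI / 3).
  { assert (H0 := acos_bound_lt (- (1 / l)) ltac:(lra)).
    split; [apply H0 |].
    apply cos_decreasing_0; try lra.
    rewrite cos_acos by lra.
    replace (2 * PI / 3) with (2 * (PI / 3)) by field.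
    rewrite cos_2PI3. apply Hb. }
  assert (HS := touching_piece_asymptote k l Hl).
  set (T := acos (- (1 / l))) in *.
  assert (Hleft : touching_pole k l < 2 * PI / 3 -> sign_z k = 1 ->
    touching_pole k l = - sign_x k * T ->
    is_asymptote (touching_curve l) (touching_pole k l)
      (image (touching_asymptote k l))).
  { intros Hp Hz E. rewrite E in *. revert HS. apply is_asymptote_ext_loc.
    apply filter_le_within. generalize (open_lt (2 * PI / 3) _ Hp).
    apply filter_imp. intros t Ht. unfold touching_curve.
    destruct (Rle_dec t (2 * PI / 3)); [| lra]. now rewrite Hz, Rmult_1_l. }
  assert (Hright : 2 * PI / 3 < touching_pole k l -> sign_z k = -1 ->
    touching_pole k l = 4 * PI / 3 - - sign_x k * T ->
    is_asymptote (touching_curve l) (touching_pole k l)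
      (image (touching_asymptote k l))).
  { intros Hp Hz E. rewrite E in *.
    apply (is_asymptote_reflect _ (4 * PI / 3)) in HS.
    revert HS. apply is_asymptote_ext_loc.
    apply filter_le_within. generalize (open_gt (2 * PI / 3) _ Hp).
    apply filter_imp. intros t Ht. unfold touching_curve.
    destruct (Rle_dec t (2 * PI / 3)); [lra |]. rewrite Hz. f_equal. ring. }
  destruct k; simpl in *; fold T in Hleft, Hright |- *.
  - apply Hleft; lra.
  - apply Hleft; lra.
  - apply Hright; lra.
  - apply Hright; lra.
Qed.

(** * Asymptotes of the edge of regression *)

Lemma edge_of_regression_asymptote (k : index) :
  is_asymptote (edge_of_regression (sign_z k)) (edge_pole k)
    (image (edge_asymptote k)).
Proof.
  assert (Hcos : cos (edge_pole k) = 0).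
  { destruct k; simpl; rewrite ?cos_neg; apply cos_PI2. }
  assert (Hsin : sin (edge_pole k) = - sign_x k).
  { destruct k; simpl; rewrite ?sin_neg, sin_PI2; ring. }
  assert (He := sign_x_sqr k).
  assert (He0 : sign_x k <> 0) by (intro E; rewrite E in He; lra).
  assert (Hd : is_derive cos (edge_pole k) (sign_x k)).
  { auto_derive; [easy |]. rewrite Hsin. ring. }
  apply is_asymptote_ext_loc with (fun t => point
    ((sin t * cos t - sin t) / 3 / cos t)
    ((2 + 3 * cos t - 3 * cos t ^ 2 - 2 * cos t ^ 3) / (6 * (1 + cos t)) / cos t)
    (sign_z k * (sqrt (1 + 2 * cos t) ^ 3 / (3 * (1 + cos t))) / cos t)).
  { generalize (simple_zero_isolated _ _ _ Hd Hcos He0).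
    apply filter_imp. intros t Ht. unfold edge_of_regression, tan.
    f_equal.
    - field. exact Ht.
    - unfold Rdiv. now rewrite (Rinv_mult _ (cos t)), Rmult_assoc.
    - unfold Rdiv. now rewrite (Rinv_mult _ (cos t)), !Rmult_assoc. }
  assert (H1 : sqrt (1 + 2 * 0) = 1) by (rewrite Rmult_0_r, Rplus_0_r; apply sqrt_1).
  apply asymptote_at_simple_pole with
    (* The base point [N' / d'] has third coordinate [2 * sign_z k / 3], which is
       the point with parameter [2 / 3] of the asymptote. *)
    (d := cos) (d' := sign_x k) (x' := - (1 / 3)) (y' := sign_x k / 6)
    (z' := sign_z k * (2 * sign_x k / 3)) (m0 := 2 / 3) (c := 1 / 3).
  - exact Hd.
  - auto_derive; [easy |]. rewrite Hcos, Hsin. nra.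
  - auto_derive; rewrite Hcos; [lra |]. rewrite Hsin. field.
  - auto_derive; rewrite ?Hcos; [lra |]. rewrite Hsin, H1. field.
  - exact Hcos.
  - exact He0.
  - lra.
  - intros E. apply (f_equal (fun q : R3 => snd (fst q))) in E.
    cbn in E. rewrite Hcos in E. lra.
  - intros m. unfold edge_asymptote. rewrite Hcos, Hsin, H1.
    assert (Hx : - (1 / 3) / sign_x k = - sign_x k / 3).
    { apply (Rmult_eq_reg_r (sign_x k)); [| exact He0].
      replace (- sign_x k / 3 * sign_x k) with (- (sign_x k * sign_x k) / 3) by field.
      rewrite He. field. exact He0. }
    rewrite Hx. f_equal; field; exact He0.
Qed.

(** * The limit of the asymptotes *)

(** One argument serves both infinities: all that matters is that [1 / l] tends
    to [0] along the filter. *)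
Lemma touching_asymptote_limit (k : index) (F : (R -> Prop) -> Prop)
    {FF : Filter F} :
  F (fun l => ~ (-1 <= l <= 2)) -> filterlim Rinv F (locally 0) ->
  lines_tend_to F (touching_asymptote k) (edge_asymptote k).
Proof.
  intros HF Hinv m.
  (* The coordinates of the asymptote for [l = 1 / u]. *)
  pose (x := fun u : R => sign_x k *
    ((u ^ 2 - u + 1) / (2 * u ^ 2 + u - 1) * sqrt (1 - u ^ 2) * (1 - m))).
  pose (y := fun u : R => (2 * u ^ 2 - 2 * u - 1) / (2 * (1 - 2 * u))
    + m * ((u ^ 2 - u + 1) ^ 2 / ((1 - 2 * u) * (1 - u ^ 2)))).
  pose (z := fun u : R => sign_z k *
    (m * ((u ^ 2 - u + 1) / (1 - u ^ 2)) * sqrt (/ (1 - 2 * u)))).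
  pose (g := fun u : R => point (x u) (y u) (z u)).
  apply filterlim_ext_loc with (fun l => g (/ l)).
  { revert HF. apply filter_imp. intros l Hl. unfold g, x, y, z, touching_asymptote.
    assert (H0 : l <> 0) by lra.
    assert (H1 : l + 1 <> 0) by lra.
    assert (H2 : l - 2 <> 0) by lra.
    assert (H3 : l - 1 <> 0) by lra.
    destruct (tau_denominators_neq_0 l Hl) as [H4 H5].
    unfold tau1, tau2, tau3.
    replace (1 - (/ l) ^ 2) with (1 - 1 / l ^ 2) by (field; exact H0).
    replace (/ (1 - 2 * / l)) with (l / (l - 2)) by (field; lra).
    f_equal.
    - do 3 f_equal. field. repeat split; lra.
    - field. repeat split; lra.
    - do 3 f_equal. field. repeat split; lra. }
  apply filterlim_comp with (1 := Hinv).
  replace (edge_asymptote k m) with (g 0).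
  - apply (filterlim_point (locally 0)).
    + apply (ex_derive_continuous x). unfold x. auto_derive. lra.
    + apply (ex_derive_continuous y). unfold y. auto_derive. lra.
    + apply (ex_derive_continuous z). unfold z. auto_derive.
      repeat split; try lra. apply Rinv_0_lt_compat. lra.
  - unfold g, x, y, z, edge_asymptote.
    replace (1 - 0 ^ 2) with 1 by ring.
    replace (/ (1 - 2 * 0)) with 1 by field.
    rewrite sqrt_1.
    f_equal; field.
Qed.

Theorem theorem3 (k : index) :
  (forall l : R, ~ (-1 <= l <= 2) ->
     is_asymptote (touching_curve l) (touching_pole k l)
       (image (touching_asymptote k l))) /\
  is_asymptote (edge_of_regression (sign_z k)) (edge_pole k)
    (image (edge_asymptote k)) /\
  lines_tend_to (Rbar_locally p_infty) (touching_asymptote k) (edge_asymptote k) /\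
  lines_tend_to (Rbar_locally m_infty) (touching_asymptote k) (edge_asymptote k).
Proof.
  split; [| split; [| split]].
  - intros l. apply touching_curve_asymptote.
  - apply edge_of_regression_asymptote.
  - apply (touching_asymptote_limit k (Rbar_locally p_infty)).
    + exists 2. intros l Hl. lra.
    + now apply (filterlim_Rbar_inv p_infty).
  - apply (touching_asymptote_limit k (Rbar_locally m_infty)).
    + exists (-1). intros l Hl. lra.
    + now apply (filterlim_Rbar_inv m_infty).
Qed.
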